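(* Consider the forward process $q(x_1,\dots,x_T\mid x_0,c)=\prod_{t=1}^T q(x_t\mid x_{t-1},x_0,c)$ with transition kernels $$q(x_t\mid x_{t-1},x_0,c)=\mathcal N\big(x_t;\ \sqrt{\alpha_t}\,x_{t-1}+b_t(x_0,c)-\sqrt{\alpha_t}\,b_{t-1}(x_0,c),\ \beta_t I\big),$$ and marginals $$q(x_t\mid x_0,c)=\mathcal N\big(x_t;\ \sqrt{\bar\alpha_t}\,x_0+b_t(x_0,c),\ (1-\bar\alpha_t)I\big),\qquad t=1,\dots,T.$$ Then for every $t$ with $1<t\le T$ the posterior distribution of $x_{t-1}$ given $(x_t,x_0,c)$ is the Gaussian $$q(x_{t-1}\mid x_t,x_0,c)=\mathcal N\Big(x_{t-1};\ \tfrac{\sqrt{\bar\alpha_{t-1}}\,\beta_t}{1-\bar\alpha_t}x_0+\tfrac{\sqrt{\alpha_t}\,(1-\bar\alpha_{t-1})}{1-\bar\alpha_t}\big(x_t-b_t(x_0,c)\big)+b_{t-1}(x_0,c),\ \tfrac{(1-\bar\alpha_{t-1})\beta_t}{1-\bar\alpha_t}I\Big).$$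
   Context: $T\ge 1$ is an integer; $x_0,x_1,\dots,x_T\in\mathbb R^d$; $c$ is a condition taking values in some set $\mathcal C$. Noise schedule: $\alpha_t\in(0,1)$ for $t=1,\dots,T$, $\beta_t=1-\alpha_t$, $\bar\alpha_t=\prod_{s=1}^t\alpha_s$, with $\bar\alpha_0=1$. $r_\phi:\mathbb R^d\times\mathcal C\times\{0,1,\dots,T\}\to\mathbb R^d$ is a (measurable) function, $k_t=\sqrt{\bar\alpha_t}\,(1-\sqrt{\bar\alpha_t})$ (so $k_0=0$), and $b_t(x_0,c)=k_t r_\phi(x_0,c,t)$. $\mathcal N(x;\mu,\Sigma)$ denotes the Gaussian distribution in the variable $x$ with mean $\mu$ and covariance $\Sigma$; $I$ is the $d\times d$ identity matrix. *)

(* Defs.v *)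
From HB Require Import structures.
From mathcomp Require Import all_boot all_order all_algebra.
From mathcomp Require Import all_classical all_reals all_analysis.

Set Implicit Arguments.
Unset Strict Implicit.
Unset Printing Implicit Defensive.

Import Order.TTheory GRing.Theory Num.Theory.
Import numFieldNormedType.Exports.

Local Open Scope classical_set_scope.
Local Open Scope ring_scope.

Definition measure_rV_display : measure_display -> measure_display.
Proof. exact. Qed.

(* Row vectors carry the product sigma-algebra, generated by the coordinates;
   over a realType this is the Borel sigma-algebra of R^n. *)
Section measurable_rV.
Context {d} {T : sigmaRingType d} (n : nat).

Let coors : 'I_n -> 'rV[T]_n -> T := fun i x => x ord0 i.

Let rV_set0 : g_sigma_preimage coors set0.
Proof. exact: sigma_algebra0. Qed.

Let rV_setC A : g_sigma_preimage coors A -> g_sigma_preimage coors (~` A).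
Proof. exact: sigma_algebraC. Qed.

Let rV_bigcup (F : (set 'rV[T]_n)^nat) :
  (forall i, g_sigma_preimage coors (F i)) ->
  g_sigma_preimage coors (\bigcup_i F i).
Proof. exact: sigma_algebra_bigcup. Qed.

HB.instance Definition _ := @isMeasurable.Build (measure_rV_display d)
  'rV[T]_n (g_sigma_preimage coors) rV_set0 rV_setC rV_bigcup.

End measurable_rV.

Lemma measurable_rV_coord d (T : measurableType d) n (i : 'I_n) :
  measurable_fun [set: 'rV[T]_n] (fun x : 'rV[T]_n => x ord0 i).
Proof.
move=> _ Y mY; rewrite setTI; apply: sub_sigma_algebra => /=.
rewrite -bigcup_seq/=; exists i => /=; first by rewrite mem_index_enum.
by exists Y => //; rewrite setTI.
Qed.

(* lebesgue_measure lives on measurableTypeR R, a copy of R that carries the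
   same sigma-algebra under another display; row_of_tuple also moves from that
   copy to R itself. *)
Definition row_of_tuple (R : realType) n (v : n.-tuple (measurableTypeR R)) :
    'rV[R]_n :=
  \row_(i < n) tnth v i.

Definition tuple_of_row (R : realType) n (x : 'rV[R]_n) :
    n.-tuple (measurableTypeR R) :=
  [tuple x ord0 i | i < n].

Lemma row_of_tupleK (R : realType) n :
  cancel (@row_of_tuple R n) (@tuple_of_row R n).
Proof. by move=> v; apply: eq_from_tnth => i; rewrite tnth_mktuple mxE. Qed.

Lemma measurable_row_of_tuple (R : realType) n :
  measurable_fun [set: n.-tuple (measurableTypeR R)] (@row_of_tuple R n).
Proof.
move=> _; apply: (@measurability _ _ _ _ _ _ (\big[setU/set0]_(i < n)
  preimage_set_system setT (fun x : 'rV[R]_n => x ord0 i) measurable)) => //.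
move=> _ [B + <-]; rewrite -bigcup_seq/= => -[i _ [A mA <-]].
rewrite !setTI -comp_preimage.
rewrite (_ : _ \o _ = (@tnth n (measurableTypeR R))^~ i).
  by rewrite -[_ @^-1` _]setTI; exact: measurable_tnth.
by apply/funext => v /=; rewrite mxE.
Qed.

HB.instance Definition _ (R : realType) n :=
  isMeasurableFun.Build _ _ (n.-tuple (measurableTypeR R)) 'rV[R]_n
    (@row_of_tuple R n) (@measurable_row_of_tuple R n).

Lemma measurable_tuple_of_row (R : realType) n :
  measurable_fun [set: 'rV[R]_n] (@tuple_of_row R n).
Proof.
apply/measurable_fun_tnthP => i.
rewrite (_ : _ \o _ = fun x : 'rV[R]_n => x ord0 i).
  exact: measurable_rV_coord.
by apply/funext => x /=; rewrite tnth_mktuple.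
Qed.

Definition cons_pair (T : Type) n (p : T * n.-tuple T) : n.+1.-tuple T :=
  [tuple of p.1 :: p.2].

Definition uncons (T : Type) n (v : n.+1.-tuple T) : T * n.-tuple T :=
  (thead v, [tuple of behead v]).

Lemma cons_pairK (T : Type) n : cancel (@cons_pair T n) (@uncons T n).
Proof. by case=> x v; congr pair => //; apply: val_inj. Qed.

Lemma measurable_cons_pair d (T : measurableType d) n :
  measurable_fun [set: T * n.-tuple T] (@cons_pair T n).
Proof. exact: measurable_cons. Qed.

HB.instance Definition _ d (T : measurableType d) n :=
  isMeasurableFun.Build _ _ (T * n.-tuple T)%type (n.+1.-tuple T)
    (@cons_pair T n) (@measurable_cons_pair d T n).

Lemma measurable_uncons d (T : measurableType d) n :
  measurable_fun [set: n.+1.-tuple T] (@uncons T n).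
Proof.
apply/measurable_fun_pair; first exact: measurable_tnth.
exact: measurable_behead.
Qed.

Lemma sigma_finite_pushforward d1 d2 (T1 : measurableType d1)
    (T2 : measurableType d2) (R : realType)
    (mu : set T1 -> \bar R) (f : T1 -> T2) (g : T2 -> T1) :
  cancel f g -> measurable_fun setT g -> sigma_finite setT mu ->
  sigma_finite setT (pushforward mu f).
Proof.
move=> fK mg [F FT mF].
exists (fun i => g @^-1` F i); first by rewrite -preimage_bigcup -FT.
move=> i; have [mFi Foo] := mF i; split.
  by rewrite -[_ @^-1` _]setTI; exact: mg.
rewrite /pushforward -comp_preimage (_ : g \o f = id)//.
by apply/funext => x /=; rewrite fK.
Qed.

(* The library has an instance for this, but a later one on the same key shadows
   it. *)
Lemma sigma_finite_product d1 d2 (T1 : measurableType d1)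
    (T2 : measurableType d2) (R : realType)
    (mu : {sigma_finite_measure set T1 -> \bar R})
    (nu : {sigma_finite_measure set T2 -> \bar R}) :
  sigma_finite setT (mu \x nu)%E.
Proof.
have /sigma_finiteP[F [FT ndF mF]] := sigma_finiteT mu.
have /sigma_finiteP[G [GT ndG mG]] := sigma_finiteT nu.
exists (fun n => F n `*` G n).
  rewrite -setXTT FT GT; apply/seteqP; split=> -[x y] /=.
    move=> [[n _ Fnx] [k _ Gky]]; exists (maxn n k) => //; split.
      by move: x Fnx; exact/subsetPset/ndF/leq_maxl.
    by move: y Gky; exact/subsetPset/ndG/leq_maxr.
  by move=> [n _ [? ?]]; split; exists n.
move=> k; have [? ?] := mF k; have [? ?] := mG k.
split; first exact: measurableX.
by rewrite product_measure1E// lte_mul_pinfty// ge0_fin_numE.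
Qed.

Section product_power.
Context d (T : measurableType d) (R : realType).

Section cons_measure.
Variables (n : nat) (mu : {sigma_finite_measure set T -> \bar R}).
Variable nu : {sigma_finite_measure set (n.-tuple T) -> \bar R}.

Definition cons_measure : set (n.+1.-tuple T) -> \bar R :=
  pushforward (mu \x nu)%E (@cons_pair T n).

Let cons_measure0 : cons_measure set0 = 0%E.
Proof. exact: measure0. Qed.

Let cons_measure_ge0 A : (0 <= cons_measure A)%E.
Proof. exact: measure_ge0. Qed.

Let cons_measure_sigma_additive : semi_sigma_additive cons_measure.
Proof. exact: measure_semi_sigma_additive. Qed.

HB.instance Definition _ := isMeasure.Build _ _ _ cons_measure
  cons_measure0 cons_measure_ge0 cons_measure_sigma_additive.

Let cons_measure_sigma_finite : sigma_finite setT cons_measure.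
Proof.
apply: sigma_finite_pushforward (@measurable_uncons d T n) _.
  exact: cons_pairK.
exact: sigma_finite_product.
Qed.

HB.instance Definition _ := Measure_isSigmaFinite.Build _ _ _ cons_measure
  cons_measure_sigma_finite.

End cons_measure.

(* the n-fold product mu \x ... \x mu *)
Fixpoint power_measure (mu : {sigma_finite_measure set T -> \bar R}) n :
    {sigma_finite_measure set (n.-tuple T) -> \bar R} :=
  match n with
  | 0 => \d_([tuple] : 0.-tuple T)
  | m.+1 => cons_measure mu (power_measure mu m)
  end.

End product_power.

Section lebesgue_rV.
Context (R : realType) (n : nat).

Definition lebesgue_rV : set 'rV[R]_n -> \bar R :=
  pushforward (power_measure (@lebesgue_measure R) n) (@row_of_tuple R n).

Let lebesgue_rV0 : lebesgue_rV set0 = 0%E.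
Proof. exact: measure0. Qed.

Let lebesgue_rV_ge0 A : (0 <= lebesgue_rV A)%E.
Proof. exact: measure_ge0. Qed.

Let lebesgue_rV_sigma_additive : semi_sigma_additive lebesgue_rV.
Proof. exact: measure_semi_sigma_additive. Qed.

HB.instance Definition _ := isMeasure.Build _ _ _ lebesgue_rV
  lebesgue_rV0 lebesgue_rV_ge0 lebesgue_rV_sigma_additive.

Let lebesgue_rV_sigma_finite : sigma_finite setT lebesgue_rV.
Proof.
apply: sigma_finite_pushforward (@measurable_tuple_of_row R n) _.
  exact: row_of_tupleK.
exact: sigma_finiteT.
Qed.

HB.instance Definition _ := Measure_isSigmaFinite.Build _ _ _ lebesgue_rV
  lebesgue_rV_sigma_finite.

End lebesgue_rV.

Section gaussian.
Context (R : realType) (n : nat).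
Implicit Types (m x : 'rV[R]_n) (S : 'M[R]_n).

Definition gaussian_pdf m S x : R :=
  (Num.sqrt ((2 * pi) ^+ n * \det S))^-1 *
  expR (- ((x - m) *m invmx S *m (x - m)^T) ord0 ord0 / 2).

(* meaningful for S symmetric positive definite *)
Definition gaussian_law m S (A : set 'rV[R]_n) : \bar R :=
  (\int[@lebesgue_rV R n]_(x in A) (gaussian_pdf m S x)%:E)%E.

End gaussian.

(* k is (a version of) the regular conditional distribution of X given Y *)
Definition regular_cond_law d d1 d2 (Om : measurableType d)
    (V : measurableType d1) (W : measurableType d2) (R : realType)
    (P : probability Om R) (X : Om -> V) (Y : Om -> W)
    (k : R.-pker W ~> V) : Prop :=
  forall (A : set V) (B : set W), measurable A -> measurable B ->
    P (X @^-1` A `&` Y @^-1` B) = (\int[P]_(w in Y @^-1` B) k (Y w) A)%E.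

Section diffusion.
Context (R : realType) (d : nat) (C : Type).
Variables (alpha : nat -> R) (r : 'rV[R]_d -> C -> nat -> 'rV[R]_d).
Implicit Types (x xt : 'rV[R]_d) (c : C) (t : nat).

Definition beta t : R := 1 - alpha t.

Definition alphabar t : R := \prod_(1 <= s < t.+1) alpha s.

Definition kshift t : R := Num.sqrt (alphabar t) * (1 - Num.sqrt (alphabar t)).

Definition bshift t x0 c : 'rV[R]_d := kshift t *: r x0 c t.

Definition transition_mean x0 c t x : 'rV[R]_d :=
  Num.sqrt (alpha t) *: x + bshift t x0 c
  - Num.sqrt (alpha t) *: bshift t.-1 x0 c.

Definition transition_pdf x0 c t x xt : R :=
  gaussian_pdf (transition_mean x0 c t x) (beta t)%:M xt.

Definition marginal_mean x0 c t : 'rV[R]_d :=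
  Num.sqrt (alphabar t) *: x0 + bshift t x0 c.

Definition posterior_mean x0 c t xt : 'rV[R]_d :=
  (Num.sqrt (alphabar t.-1) * beta t / (1 - alphabar t)) *: x0
  + (Num.sqrt (alpha t) * (1 - alphabar t.-1) / (1 - alphabar t))
      *: (xt - bshift t x0 c)
  + bshift t.-1 x0 c.

Definition posterior_var t : R :=
  (1 - alphabar t.-1) * beta t / (1 - alphabar t).

(* The tuple v lists x_1, ..., x_T, so its entry of index t is x_(t+1);
   state x0 v t is x_t for every t in 0..T. *)
Definition state (T : nat) x0 (v : T.-tuple 'rV[R]_d) t : 'rV[R]_d :=
  nth 0 (x0 :: v) t.

Definition forward_pdf (T : nat) x0 c (v : T.-tuple 'rV[R]_d) : R :=
  \prod_(1 <= t < T.+1)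
    transition_pdf x0 c t (state x0 v t.-1) (state x0 v t).

Definition forward_law (T : nat) x0 c (A : set (T.-tuple 'rV[R]_d)) : \bar R :=
  (\int[power_measure (@lebesgue_rV R d) T]_(v in A)
      (forward_pdf x0 c v)%:E)%E.

End diffusion.

(* Main.v *)
(** The posterior formula is a pointwise Bayes identity between densities: with
    p_t the claimed marginal density, K_t the transition density and b_t the
    claimed posterior density, p_(t-1)(x) K_t(x, y) = p_t(y) b_t(y, x).  For
    isotropic covariances this splits over coordinates and reduces to completing
    a square.  Integrating it in x gives Chapman-Kolmogorov, hence the marginals
    by induction on t; integrating it over A x B with Tonelli gives the joint law
    of (x_(t-1), x_t), in which b_t appears as the conditional density. *)

Require Import Defs.
From HB Require Import structures.
From mathcomp Require Import all_boot all_order all_algebra.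
From mathcomp Require Import all_classical all_reals all_analysis.
From mathcomp Require Import measurable_realfun.
From mathcomp Require Import ring.

Set Implicit Arguments.
Unset Strict Implicit.
Unset Printing Implicit Defensive.

Import Order.TTheory GRing.Theory Num.Theory.
Import numFieldNormedType.Exports.

Local Open Scope classical_set_scope.
Local Open Scope ring_scope.

(** * Integration against a measure given by a density *)

Section density.
Context d (T : measurableType d) (R : realType).
Variables (mu nu : {measure set T -> \bar R}) (p : T -> R).
Hypothesis p0 : forall x, 0 <= p x.
Hypothesis mp : measurable_fun [set: T] p.
Hypothesis nuE : forall A, measurable A ->
  nu A = (\int[mu]_(x in A) (p x)%:E)%E.

Import HBNNSimple.

(** [nuE] is the case of indicators. Linearity over level sets extends it to simple functions, and
    monotone convergence on both sides, along increasing simple approximations, gives all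
    nonnegative [f]. *)
Lemma ge0_integral_density (f : T -> \bar R) : measurable_fun [set: T] f ->
  (forall x, 0 <= f x)%E -> (\int[nu]_x f x = \int[mu]_x (f x * (p x)%:E))%E.
Proof.
move=> mf f0; pose g := nnsfun_approx measurableT mf.
have gf x : (EFin \o g^~ x) @ \oo --> f x by exact: cvg_nnsfun_approx.
have ndg x : {homo (fun n => g n x) : m n / (m <= n)%N >-> m <= n}.
  by move=> m n mn; exact/lefP/nd_nnsfun_approx.
transitivity (limn (fun n => \int[nu]_x (g n x)%:E)%E).
  rewrite -monotone_convergence//.
  - by apply: eq_integral => x _; apply/esym/cvg_lim => //; exact: gf.
  - by move=> n; exact/measurable_EFinP.
  - by move=> n x _; rewrite lee_fin.
  - by move=> x _ m n mn; rewrite lee_fin ndg.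
rewrite [X in limn X](_ : _ = fun n => (\int[mu]_x (g n x * p x)%:E)%E).
  rewrite -monotone_convergence//.
  - apply: eq_integral => x _; apply/cvg_lim => //.
    under eq_cvg do rewrite EFinM.
    by apply: cvgeZr => //; exact: gf.
  - by move=> n; apply/measurable_EFinP; exact: measurable_funM.
  - by move=> n x _; rewrite lee_fin mulr_ge0.
  - by move=> x _ m n mn; rewrite lee_fin ler_wpM2r ?ndg.
apply/funext => n.
rewrite integralT_nnsfun sintegralE.
transitivity (\sum_(r \in range (g n))
    \int[mu]_x (r * \1_(g n @^-1` [set r]) x * p x)%:E)%E.
  apply: eq_fsbigr => r; rewrite inE/= => -[t _ rE].
  have r0 : 0 <= r by rewrite -rE.
  under eq_integral do rewrite -mulrA EFinM.
  rewrite ge0_integralZl_EFin//; last 2 first.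
  - by move=> x _; rewrite lee_fin mulr_ge0.
  - by apply/measurable_EFinP; exact: measurable_funM.
  rewrite nuE// integral_mkcond; congr (_ * _)%E.
  by apply: eq_integral => x _; rewrite epatch_indic muleC -EFinM.
rewrite -ge0_integral_fsum//=; last 2 first.
- move=> r; apply/measurable_EFinP; apply: measurable_funM => //.
  exact: measurable_funM.
- move=> r x _; rewrite lee_fin mulr_ge0//.
  by rewrite -lee_fin nnfun_muleindic_ge0.
apply: eq_integral => x _; rewrite fsumEFin// fimfunE mulr_fsuml//.
Qed.
End density.

(** * Path densities on tuples and iterated integrals *)

Section chain.
Context d (S : measurableType d) (R : realType).
Variable mu : {sigma_finite_measure set S -> \bar R}.

(** Change of variables along [cons_pair] followed by Tonelli. The head is integrated outermost, so
    inductions below peel off the first state. *)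
Lemma ge0_integral_power_measureS n (f : n.+1.-tuple S -> \bar R) :
  measurable_fun [set: n.+1.-tuple S] f -> (forall v, 0 <= f v)%E ->
  (\int[power_measure mu n.+1]_v f v =
   \int[mu]_y \int[power_measure mu n]_v f (cons_pair (y, v)))%E.
Proof.
move=> mf f0 /=.
rewrite (ge0_integral_pushforward (@measurable_cons_pair _ S n))//.
rewrite preimage_setT fubini_tonelli1//; last by move=> p; exact: f0.
by apply: measurableT_comp mf (@measurable_cons_pair _ S n).
Qed.

(** Path density of a time-inhomogeneous Markov chain started at [x], with [K i] the density of step
    [i]. Shifting the family [K] in the recursive call keeps time 0 at the current head. *)
Fixpoint chain (K : nat -> S -> S -> R) (x : S) (s : seq S) : R :=
  if s is y :: s' then K 0 x y * chain (fun i => K i.+1) y s' else 1.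

Definition jointly_measurable (h : S -> S -> R) :=
  measurable_fun [set: S * S] (fun p => h p.1 p.2).

Lemma jointly_measurable_comp d' (U : measurableType d') h (f g : U -> S) :
  jointly_measurable h -> measurable_fun [set: U] f ->
  measurable_fun [set: U] g -> measurable_fun [set: U] (fun x => h (f x) (g x)).
Proof.
move=> mh mf mg; apply: (measurableT_comp mh (g := fun x => (f x, g x))).
exact: measurable_fun_pair.
Qed.

Lemma jointly_measurabler h x : jointly_measurable h ->
  measurable_fun [set: S] (h x).
Proof. by move=> mh; exact: jointly_measurable_comp. Qed.

Lemma measurable_chain K n : (forall i, jointly_measurable (K i)) ->
  measurable_fun [set: S * n.-tuple S] (fun p => chain K p.1 p.2).
Proof.
elim: n K => [|n IH] K mK.
  rewrite (_ : (fun _ => _) = cst 1)//.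
  by apply/funext => -[x v]; rewrite tuple0.
(* Expressed through [uncons], one unfolding of the recursion becomes a product of compositions of
   measurable maps. *)
rewrite (_ : (fun _ => _) = fun p : S * n.+1.-tuple S =>
    K 0 p.1 (uncons p.2).1 *
    chain (fun i => K i.+1) (uncons p.2).1 (uncons p.2).2); last first.
  by apply/funext => -[x v]; rewrite [in LHS](tuple_eta v).
have mu2 : measurable_fun [set: S * n.+1.-tuple S] (fun p => uncons p.2).
  by apply: measurableT_comp => //; exact: measurable_uncons.
apply: measurable_funM.
  by apply: (jointly_measurable_comp (mK 0)) => //; exact: measurableT_comp.
exact: (measurableT_comp (IH (fun i => K i.+1) (fun i => mK i.+1)) mu2).
Qed.

Lemma measurable_chainr K n x : (forall i, jointly_measurable (K i)) ->
  measurable_fun [set: n.-tuple S] (fun v => chain K x v).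
Proof.
move=> mK.
apply: (measurableT_comp (@measurable_chain K n mK) (g := fun v => (x, v))).
exact: measurable_pair1.
Qed.

Lemma chain_ge0 K x s : (forall i x y, 0 <= K i x y) -> 0 <= chain K x s.
Proof.
move=> K0; elim: s x K K0 => //= y s IH x K K0.
by rewrite mulr_ge0 ?K0// IH.
Qed.

(** Bridge between products indexed by time and the recursive form. All indices stay below [n], so
    the default [z] is never read. *)
Lemma prod_chain K z x n (v : n.-tuple S) :
  \prod_(0 <= i < n) K i (nth z (x :: v) i) (nth z v i) = chain K x v.
Proof.
elim: n K x v => [|n IH] K x v; first by rewrite big_nil tuple0.
rewrite big_nat_recl// {1 2}(tuple_eta v)/= [in RHS](tuple_eta v)/=.
rewrite -(IH _ _ [tuple of behead v]); congr (_ * _).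
by apply: eq_bigr => i _; rewrite [in LHS](tuple_eta v).
Qed.

(** Once the first new state is fixed, the rest of the path integrates to 1 by induction on the
    shifted kernels; only the first kernel, of mass 1, remains. *)
Lemma integral_chain K n x :
  (forall i, jointly_measurable (K i)) -> (forall i x y, 0 <= K i x y) ->
  (forall i, (i < n)%N -> forall x, \int[mu]_y (K i x y)%:E = 1)%E ->
  (\int[power_measure mu n]_v (chain K x v)%:E = 1)%E.
Proof.
elim: n K x => [|n IH] K x mK K0 K1.
  rewrite (eq_integral (cst 1%E)); last by move=> v _; rewrite tuple0.
  by rewrite integral_cst// mul1e; exact: diracT.
rewrite ge0_integral_power_measureS; last 2 first.
- apply/measurable_EFinP; exact: measurable_chainr.
- by move=> v; rewrite lee_fin chain_ge0.
rewrite -[RHS](K1 0%N (ltn0Sn _) x); apply: eq_integral => y _ /=.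
under eq_integral do rewrite EFinM.
rewrite ge0_integralZl_EFin ?IH ?mule1//.
- by move=> i i_lt; exact: K1.
- by move=> v _; rewrite lee_fin chain_ge0.
- by apply/measurable_EFinP; exact: measurable_chainr.
Qed.

Lemma measurable_tuple_nth n t (z : S) : (t < n)%N ->
  measurable_fun [set: n.-tuple S] (fun v => nth z v t).
Proof.
move=> tn; rewrite (_ : (fun _ => _) = fun v => tnth v (Ordinal tn)).
  exact: measurable_tnth.
by apply/funext => v; rewrite (tnth_nth z).
Qed.

Lemma measurable_cons_nth n t (z x : S) : (t <= n)%N ->
  measurable_fun [set: n.-tuple S] (fun v => nth z (x :: v) t).
Proof. by case: t => //= t tn; exact: measurable_tuple_nth. Qed.

(** The transition operator acting on functions: the expectation of [G] after one step from [x]. *)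
Definition kernel_op (k : S -> S -> R) (G : S -> \bar R) (x : S) : \bar R :=
  (\int[mu]_y ((k x y)%:E * G y))%E.

Fixpoint iter_kernel_op (K : nat -> S -> S -> R) t (G : S -> \bar R) :=
  if t is t'.+1 then kernel_op (K 0) (iter_kernel_op (fun i => K i.+1) t' G)
  else G.

(** The recursion peels off the first kernel, whereas induction forward in time appends a last
    one. *)
Lemma iter_kernel_opSr K t G :
  iter_kernel_op K t.+1 G = iter_kernel_op K t (kernel_op (K t) G).
Proof. by elim: t K => //= t IH K; rewrite -IH. Qed.

(** [h] sees the states of index [t] and [t.+1], the path being numbered from its start [x] at 0.
    Earlier steps become transition operators, and later ones integrate to 1 by [integral_chain]. *)
Lemma integral_chain_pair K h n t x z : (t < n)%N ->
  jointly_measurable h -> (forall y w, 0 <= h y w) ->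
  (forall i, jointly_measurable (K i)) -> (forall i x y, 0 <= K i x y) ->
  (forall i, (i < n)%N -> forall x, \int[mu]_y (K i x y)%:E = 1)%E ->
  (\int[power_measure mu n]_v
     (h (nth z (x :: v) t) (nth z v t) * chain K x v)%:E =
   iter_kernel_op K t (fun y => \int[mu]_w (h y w * K t y w)%:E) x)%E.
Proof.
move=> tn mh h0.
have mF L m s y : (s < m)%N -> (forall i, jointly_measurable (L i)) ->
    measurable_fun [set: m.-tuple S]
      (fun v => (h (nth z (y :: v) s) (nth z v s) * chain L y v)%:E).
  move=> sm mL; apply/measurable_EFinP.
  apply: measurable_funM; last exact: measurable_chainr.
  apply: (jointly_measurable_comp mh); last exact: measurable_tuple_nth.
  by apply: measurable_cons_nth; exact: ltnW.
have F0 L m s y v : (forall i x y, 0 <= L i x y) ->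
    (0 <= (h (nth z (y :: v) s) (nth z v s) * chain L y v)%:E)%E.
  by move=> L0; rewrite lee_fin mulr_ge0// chain_ge0.
elim: t n K x tn => [|t IH] [//|n] K x tn mK K0 K1.
  rewrite ge0_integral_power_measureS; last 2 first.
  - exact: mF.
  - by move=> v; exact: F0.
  apply: eq_integral => y _ /=.
  under eq_integral do rewrite mulrA EFinM.
  rewrite ge0_integralZl_EFin ?mulr_ge0//; last 2 first.
  - by move=> v _; rewrite lee_fin chain_ge0.
  - by apply/measurable_EFinP; exact: measurable_chainr.
  rewrite integral_chain ?mule1//.
  by move=> i i_lt; exact: K1.
rewrite ge0_integral_power_measureS; last 2 first.
- exact: mF.
- by move=> v; exact: F0.
apply: eq_integral => y _ /=.
under eq_integral do rewrite mulrCA EFinM.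
rewrite ge0_integralZl_EFin//; last 2 first.
- by move=> v _; exact: F0.
- exact: mF.
rewrite IH//.
by move=> i i_lt; exact: K1.
Qed.

End chain.

(** * Laws of one state and of two consecutive states, from a Bayes identity *)

Section markov_chain.
Context d (S : measurableType d) (R : realType).
Variable mu : {sigma_finite_measure set S -> \bar R}.
Variables (T : nat) (K : nat -> S -> S -> R) (x0 : S).
Hypotheses (mK : forall t, jointly_measurable (K t))
  (K0 : forall t x y, 0 <= K t x y)
  (K1 : forall t, (t < T)%N -> forall x, (\int[mu]_y (K t x y)%:E = 1)%E).
(* p t is the density of the state of index t.+1, and b t the density of the
   state of index t.+1 given that of index t.+2. *)
Variables (p : nat -> S -> R) (b : nat -> S -> S -> R).
Hypotheses (mp : forall t, measurable_fun [set: S] (p t))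
  (p0 : forall t x, 0 <= p t x) (pK : p 0 = K 0 x0).
Hypotheses (mb : forall t, jointly_measurable (b t))
  (b0 : forall t x y, 0 <= b t x y)
  (b1 : forall t, (t.+1 < T)%N -> forall y, (\int[mu]_x (b t y x)%:E = 1)%E)
  (bayes : forall t, (t.+1 < T)%N ->
    forall x y, p t x * K t.+1 x y = p t.+1 y * b t y x).

(** By [bayes] the integrand is [p t.+1 y] times a backward density in [x], which has mass 1. *)
Lemma chapman_kolmogorov t y : (t.+1 < T)%N ->
  (\int[mu]_x (p t x * K t.+1 x y)%:E = (p t.+1 y)%:E)%E.
Proof.
move=> tT; under eq_integral do rewrite bayes// EFinM.
rewrite ge0_integralZl_EFin//; last 2 first.
- by move=> x _; rewrite lee_fin.
- by apply/measurable_EFinP; exact: jointly_measurabler.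
by rewrite b1// mule1.
Qed.

(** Induction on [t] for all [G] at once: the last kernel is absorbed into [G], the induction
    hypothesis applies, and Tonelli with Chapman-Kolmogorov turns [p t] into [p t.+1]. *)
Lemma iter_kernel_op_density t (G : S -> \bar R) : (t < T)%N ->
  measurable_fun [set: S] G -> (forall x, 0 <= G x)%E ->
  iter_kernel_op mu K t.+1 G x0 = (\int[mu]_y ((p t y)%:E * G y))%E.
Proof.
elim: t G => [|t IH] G tT mG G0; first by rewrite pK.
have mKG : measurable_fun [set: S * S] (fun q => (K t.+1 q.1 q.2)%:E * G q.2)%E.
  apply: emeasurable_funM; last exact: measurableT_comp.
  by apply/measurable_EFinP; exact: mK.
have KG0 x y : (0 <= (K t.+1 x y)%:E * G y)%E by rewrite mule_ge0// lee_fin.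
rewrite iter_kernel_opSr IH//; last 3 first.
- exact: ltnW.
- exact: (@measurable_fun_fubini_tonelli_F _ _ _ _ _ mu _ mKG).
- by move=> x; apply: integral_ge0.
transitivity (\int[mu]_x \int[mu]_y ((p t x * K t.+1 x y)%:E * G y))%E.
  apply: eq_integral => x _; rewrite -ge0_integralZl_EFin//.
  - by apply: eq_integral => y _; rewrite EFinM muleA.
  - exact: (measurableT_comp mKG (measurable_pair1 x)).
rewrite (@fubini_tonelli _ _ _ _ _ mu mu
  (fun q => (p t q.1 * K t.+1 q.1 q.2)%:E * G q.2)%E)/=; last 2 first.
- apply: emeasurable_funM; last exact: measurableT_comp.
  apply/measurable_EFinP; apply: measurable_funM; last exact: mK.
  exact: measurableT_comp.
- by move=> q; rewrite EFinM -muleA mule_ge0// lee_fin.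
apply: eq_integral => y _.
rewrite ge0_integralZr//; last 2 first.
- apply/measurable_EFinP; apply: measurable_funM => //.
  exact: (jointly_measurable_comp (mK _)).
- by move=> x _; rewrite lee_fin mulr_ge0.
by rewrite chapman_kolmogorov.
Qed.

Let jointly_measurable_indic (A B : set S) : measurable A -> measurable B ->
  jointly_measurable (fun x y => \1_A x * \1_B y : R).
Proof.
move=> mA mB; apply: measurable_funM.
- by apply: measurableT_comp => //; exact: measurable_indic.
- by apply: measurableT_comp => //; exact: measurable_indic.
Qed.

Lemma markov_chain_marginal t z (A : set S) : (t < T)%N -> measurable A ->
  (\int[power_measure mu T]_v (\1_A (nth z v t) * chain K x0 v)%:E =
   \int[mu]_y (p t y * \1_A y)%:E)%E.
Proof.
move=> tT mA.
have mh : jointly_measurable (fun _ y => \1_A y : R).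
  by apply: measurableT_comp => //; exact: measurable_indic.
rewrite (@integral_chain_pair _ _ _ mu K (fun _ y => \1_A y) T t x0 z)//.
under [X in iter_kernel_op _ _ _ X]eq_fun do
  under eq_integral do rewrite mulrC EFinM.
(* The inner integral is, by conversion, one more transition operator applied to the indicator of
   [A]. *)
rewrite -[LHS]/(iter_kernel_op mu K t (kernel_op mu (K t) (EFin \o \1_A)) x0).
rewrite -iter_kernel_opSr.
rewrite iter_kernel_op_density//.
  by apply/measurable_EFinP; exact: measurable_indic.
by move=> x; rewrite lee_fin.
Qed.

Lemma markov_chain_joint t z (A B : set S) :
  (t.+1 < T)%N -> measurable A -> measurable B ->
  (\int[power_measure mu T]_v
     (\1_A (nth z v t) * \1_B (nth z v t.+1) * chain K x0 v)%:E =
   \int[mu]_y ((p t.+1 y * \1_B y)%:E * \int[mu]_x (b t y x * \1_A x)%:E))%E.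
Proof.
move=> tT mA mB.
(* Entry [t] of [v] is entry [t.+1] of [x0 :: v], so the pair lemma is used at [t.+1]. *)
rewrite (@integral_chain_pair _ _ _ mu K (fun x y => \1_A x * \1_B y) T t.+1 x0 z)//;
  last exact: jointly_measurable_indic.
have mh : measurable_fun [set: S * S]
    (fun q => (\1_A q.1 * \1_B q.2 * K t.+1 q.1 q.2)%:E).
  apply/measurable_EFinP; apply: measurable_funM; last exact: mK.
  exact: jointly_measurable_indic.
rewrite iter_kernel_op_density//; last 3 first.
- exact: ltnW.
- apply: (@measurable_fun_fubini_tonelli_F _ _ _ _ _ mu _ mh).
  by move=> q; rewrite lee_fin !mulr_ge0.
- by move=> x; apply: integral_ge0 => y _; rewrite lee_fin !mulr_ge0.
(* Bayes replaces the forward factorisation of the joint density by the backward one; Tonelli then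
   moves [y] outside. *)
transitivity (\int[mu]_x \int[mu]_y
    (p t.+1 y * \1_B y * (b t y x * \1_A x))%:E)%E.
  apply: eq_integral => x _; rewrite -ge0_integralZl_EFin//; last 2 first.
  - by move=> y _; rewrite lee_fin !mulr_ge0.
  - exact: (measurableT_comp mh (measurable_pair1 x)).
  apply: eq_integral => y _; rewrite -EFinM mulrCA bayes//; congr EFin.
  by ring.
rewrite (@fubini_tonelli _ _ _ _ _ mu mu
  (fun q => (p t.+1 q.2 * \1_B q.2 * (b t q.2 q.1 * \1_A q.1))%:E))/=; last 2 first.
- apply/measurable_EFinP; apply: measurable_funM; apply: measurable_funM.
  + exact: measurableT_comp.
  + by apply: measurableT_comp => //; exact: measurable_indic.
  + exact: (jointly_measurable_comp (mb t)).
  + by apply: measurableT_comp => //; exact: measurable_indic.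
- by move=> q; rewrite lee_fin !mulr_ge0.
apply: eq_integral => y _; under eq_integral do rewrite EFinM.
rewrite ge0_integralZl_EFin ?mulr_ge0//; last 2 first.
- by move=> x _; rewrite lee_fin mulr_ge0.
- apply/measurable_EFinP; apply: measurable_funM; last exact: measurable_indic.
  exact: jointly_measurabler.
Qed.

End markov_chain.

(** * Isotropic Gaussian densities and their Bayes identity *)

(** The exponents for x of law N(m, s) and y of law N(a x + b, s') given x are regrouped as a square
    in y alone plus a square in x centred at the posterior mean. *)
Lemma complete_square (F : realFieldType) (m s a b s' x y : F) :
  0 < s -> 0 < s' -> a ^+ 2 * s + s' != 0 ->
  - (x - m) ^+ 2 / (s * 2) + - (y - (a * x + b)) ^+ 2 / (s' * 2) =
  - (y - (a * m + b)) ^+ 2 / ((a ^+ 2 * s + s') * 2) +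
  - (x - (s' * m + a * s * (y - b)) / (a ^+ 2 * s + s')) ^+ 2 /
    (s * s' / (a ^+ 2 * s + s') * 2).
Proof. by move=> s0 s'0 S0; field; rewrite S0 !gt_eqF. Qed.

Section isotropic_gaussian.
Context (R : realType) (n : nat).
Implicit Types (m x y b : 'rV[R]_n) (s : R).

Lemma measurable_fun_rVP d (U : measurableType d) (f : U -> 'rV[R]_n) :
  (forall i, measurable_fun [set: U] (fun u => f u ord0 i)) ->
  measurable_fun [set: U] f.
Proof.
move=> mf; apply: (@measurability _ _ _ _ _ _ (\big[setU/set0]_(i < n)
  preimage_set_system setT (fun x : 'rV[R]_n => x ord0 i) measurable)) => //.
move=> _ [B + <-]; rewrite -bigcup_seq/= => -[i _ [A mA <-]].
rewrite !setTI -comp_preimage -[_ @^-1` _]setTI.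
exact: mf.
Qed.

Lemma measurable_rV_fun_coord d (U : measurableType d) (f : U -> 'rV[R]_n) i :
  measurable_fun [set: U] f -> measurable_fun [set: U] (fun u => f u ord0 i).
Proof. exact: measurableT_comp (measurable_rV_coord i). Qed.

Lemma measurable_affine_rV (a : R) b :
  measurable_fun [set: 'rV[R]_n] (fun x => a *: x + b).
Proof.
apply: measurable_fun_rVP => i.
under [X in measurable_fun _ X]eq_fun do rewrite !mxE.
apply: measurable_funD => //; apply: measurable_funM => //.
exact: measurable_rV_coord.
Qed.

Lemma gaussian_pdf_ge0 m (S : 'M[R]_n) x : 0 <= gaussian_pdf m S x.
Proof. by rewrite mulr_ge0 ?invr_ge0 ?expR_ge0. Qed.

Lemma measurable_gaussian_pdf (f : 'rV[R]_n -> 'rV[R]_n) (S : 'M[R]_n) :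
  measurable_fun [set: 'rV[R]_n] f ->
  jointly_measurable (fun x => gaussian_pdf (f x) S).
Proof.
move=> mf; rewrite /jointly_measurable /gaussian_pdf.
apply: measurable_funM => //; apply: measurableT_comp => //.
apply: measurable_funM => //; apply: measurableT_comp => //.
have mfc i : measurable_fun [set: 'rV[R]_n * 'rV[R]_n]
    (fun p => (p.2 - f p.1) ord0 i).
  under [X in measurable_fun _ X]eq_fun do rewrite !mxE.
  apply: measurable_funB; apply: measurable_rV_fun_coord => //.
  exact: measurableT_comp.
under [X in measurable_fun _ X]eq_fun do rewrite mxE.
apply: measurable_sum => j.
under [X in measurable_fun _ X]eq_fun do rewrite mxE [_^T _ _]mxE.
apply: measurable_funM => //; apply: measurable_sum => i.
exact: measurable_funM.
Qed.

(** A scalar matrix has determinant [s ^+ n] and a scalar inverse, so peak and exponent both split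
    over coordinates. [normal_pdf] takes a standard deviation, hence the square root. *)
Lemma gaussian_pdf_prod m s x : 0 < s ->
  gaussian_pdf m s%:M x =
  \prod_(i < n) normal_pdf (m ord0 i) (Num.sqrt s) (x ord0 i).
Proof.
move=> s0; have ss0 : Num.sqrt s != 0 by rewrite gt_eqF// sqrtr_gt0.
under eq_bigr do rewrite normal_pdfE//.
rewrite big_split/= /gaussian_pdf; congr (_ * _).
  rewrite prodr_const card_ord exprVn det_scalar -exprMn /normal_peak.
  rewrite sqr_sqrtr ?(ltW s0)//; congr (_^-1).
  elim: n => [|k IH]; first by rewrite !expr0 sqrtr1.
  rewrite !exprSr sqrtrM ?IH; last first.
    by rewrite exprn_ge0// mulr_ge0 ?(ltW s0)// mulr_ge0 ?pi_ge0.
  by congr (_ * Num.sqrt _); rewrite mulr_natl mulrC mulrnAr.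
rewrite /normal_fun -expR_sum; congr expR.
rewrite invmx_scalar mul_mx_scalar -scalemxAl mxE mxE.
rewrite mulr_sumr -sumrN mulr_suml; apply: eq_bigr => i _.
rewrite !mxE sqr_sqrtr ?(ltW s0)// -mulr_natr.
by field; rewrite gt_eqF.
Qed.

(** Independent coordinates form a chain whose kernels do not depend on the current state, so
    [integral_chain] applies to the coordinates. *)
Lemma integral_gaussian_pdf m s : 0 < s ->
  (\int[@lebesgue_rV R n]_x (gaussian_pdf m s%:M x)%:E = 1)%E.
Proof.
move=> s0; have ss0 : Num.sqrt s != 0 by rewrite gt_eqF// sqrtr_gt0.
rewrite /lebesgue_rV (ge0_integral_pushforward (@measurable_row_of_tuple R n))//.
- pose K (i : nat) (_ y : measurableTypeR R) : R :=
    normal_pdf (nth 0 (tuple_of_row m) i) (Num.sqrt s) y.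
  rewrite preimage_setT -[RHS](@integral_chain _ _ _ lebesgue_measure K n 0)//.
  + apply: eq_integral => v _ /=.
    rewrite -(prod_chain K 0) gaussian_pdf_prod// big_mkord; congr EFin.
    apply: eq_bigr => i _; rewrite /K mxE (tnth_nth 0).
    by rewrite -(tnth_nth 0 (tuple_of_row m)) tnth_mktuple.
  + move=> i; apply: measurableT_comp => //; exact: measurable_normal_pdf.
  + by move=> i x y; exact: normal_pdf_ge0.
  + by move=> i _ x; exact: integral_normal_pdf.
- apply/measurable_EFinP.
  exact: (jointly_measurabler m (measurable_gaussian_pdf s%:M
    (@measurable_id _ _ setT))).
- by move=> x _; rewrite lee_fin gaussian_pdf_ge0.
Qed.

Lemma normal_pdf_bayes (m s a b s' x y : R) : 0 < s -> 0 < s' ->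
  normal_pdf m (Num.sqrt s) x * normal_pdf (a * x + b) (Num.sqrt s') y =
  normal_pdf (a * m + b) (Num.sqrt (a ^+ 2 * s + s')) y *
  normal_pdf ((s' * m + a * s * (y - b)) / (a ^+ 2 * s + s'))
    (Num.sqrt (s * s' / (a ^+ 2 * s + s'))) x.
Proof.
move=> s0 s'0; set S := a ^+ 2 * s + s'.
have S0 : 0 < S by rewrite ltr_wpDl// mulr_ge0 ?sqr_ge0// ltW.
have V0 : 0 < s * s' / S by rewrite !mulr_gt0 ?invr_gt0.
have sqrt_neq0 v : 0 < v -> Num.sqrt v != 0 :> R.
  by move=> v0; rewrite gt_eqF// sqrtr_gt0.
rewrite !normal_pdfE ?sqrt_neq0// mulrACA [RHS]mulrACA.
rewrite /normal_peak /normal_fun !sqr_sqrtr ?ltW//.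
have vpi_ge0 v : 0 < v -> 0 <= v * pi *+ 2 :> R.
  by move=> v0; rewrite mulrn_wge0// mulr_ge0 ?pi_ge0 ?ltW.
congr (_ * _).
  rewrite -!invfM -!sqrtrM ?vpi_ge0//; congr (Num.sqrt _)^-1.
  (* With [S] and [pi] turned into plain variables, the equality of the normalising constants is a
     rational identity. *)
  rewrite -!(mulr_natr (_ * pi)); move: S S0 V0 (pi : R) => S S0 _ p.
  by field; rewrite gt_eqF.
rewrite -!expRD -(mulr_natr s) -(mulr_natr s') -(mulr_natr S).
by rewrite -(mulr_natr (_ / _)) complete_square// gt_eqF.
Qed.

Lemma gaussian_pdf_bayes m s (a : R) b s' x y : 0 < s -> 0 < s' ->
  gaussian_pdf m s%:M x * gaussian_pdf (a *: x + b) s'%:M y =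
  gaussian_pdf (a *: m + b) (a ^+ 2 * s + s')%:M y *
  gaussian_pdf ((a ^+ 2 * s + s')^-1 *: (s' *: m + (a * s) *: (y - b)))
    (s * s' / (a ^+ 2 * s + s'))%:M x.
Proof.
move=> s0 s'0.
have S0 : 0 < a ^+ 2 * s + s' by rewrite ltr_wpDl// mulr_ge0 ?sqr_ge0// ltW.
have V0 : 0 < s * s' / (a ^+ 2 * s + s') by rewrite !mulr_gt0 ?invr_gt0.
rewrite !gaussian_pdf_prod// -!big_split; apply: eq_bigr => i _ /=.
by rewrite !mxE normal_pdf_bayes// [_^-1 * _]mulrC.
Qed.

End isotropic_gaussian.

(** * Gaussian laws as probability kernels *)

Section gaussian_kernel.
Context (R : realType) (n : nat).
Implicit Types (m : 'rV[R]_n) (S : 'M[R]_n).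

Lemma measurable_gaussian_pdfr m S :
  measurable_fun [set: 'rV[R]_n] (gaussian_pdf m S).
Proof.
exact: (jointly_measurabler m (measurable_gaussian_pdf S
  (@measurable_id _ _ setT))).
Qed.

Lemma gaussian_law_indic m S (A : set 'rV[R]_n) :
  gaussian_law m S A =
  (\int[@lebesgue_rV R n]_x (gaussian_pdf m S x * \1_A x)%:E)%E.
Proof.
rewrite /gaussian_law integral_mkcond.
by apply: eq_integral => x _; rewrite epatch_indic.
Qed.

Section measure.
Variables (m : 'rV[R]_n) (S : 'M[R]_n).

Let gaussian_law0 : gaussian_law m S set0 = 0%E.
Proof. exact: integral_set0. Qed.

Let gaussian_law_ge0 A : (0 <= gaussian_law m S A)%E.
Proof.
by apply: integral_ge0 => x _; rewrite lee_fin gaussian_pdf_ge0.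
Qed.

Let gaussian_law_sigma_additive : semi_sigma_additive (gaussian_law m S).
Proof.
move=> F mF tF mUF; rewrite /gaussian_law ge0_integral_bigcup//.
- apply: is_cvg_ereal_nneg_natsum_cond => k _ _.
  exact: gaussian_law_ge0.
- apply/measurable_funTS/measurable_EFinP.
  exact: measurable_gaussian_pdfr.
- by move=> x _; rewrite lee_fin gaussian_pdf_ge0.
Qed.

HB.instance Definition _ := isMeasure.Build _ _ _ (gaussian_law m S)
  gaussian_law0 gaussian_law_ge0 gaussian_law_sigma_additive.
End measure.

Variables (f : 'rV[R]_n -> 'rV[R]_n) (s : R).

(* The proofs mf and s0 occur in no term: they only key the kernel instances. *)
Definition gaussian_kernel (mf : measurable_fun [set: 'rV[R]_n] f) (s0 : 0 < s)
  (x : 'rV[R]_n) : {measure set 'rV[R]_n -> \bar R} := gaussian_law (f x) s%:M.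

Hypotheses (mf : measurable_fun [set: 'rV[R]_n] f) (s0 : 0 < s).

Let measurable_gaussian_kernel U : measurable U ->
  measurable_fun [set: 'rV[R]_n] (gaussian_kernel mf s0 ^~ U).
Proof.
move=> mU; rewrite /gaussian_kernel/=.
under [X in measurable_fun _ X]eq_fun do rewrite gaussian_law_indic.
apply: (@measurable_fun_fubini_tonelli_F _ _ _ _ _ (@lebesgue_rV R n)
  (fun p => (gaussian_pdf (f p.1) s%:M p.2 * \1_U p.2)%:E)).
- apply/measurable_EFinP; apply: measurable_funM.
    exact: measurable_gaussian_pdf.
  by apply: measurableT_comp => //; exact: measurable_indic.
- by move=> p; rewrite lee_fin mulr_ge0// gaussian_pdf_ge0.
Qed.

HB.instance Definition _ := isKernel.Build _ _ _ _ _ (gaussian_kernel mf s0)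
  measurable_gaussian_kernel.

Let gaussian_kernel_setT x : gaussian_kernel mf s0 x [set: _] = 1%E.
Proof. exact: integral_gaussian_pdf. Qed.

HB.instance Definition _ := Kernel_isProbability.Build _ _ _ _ _
  (gaussian_kernel mf s0) gaussian_kernel_setT.

End gaussian_kernel.

(** * Conditional laws from joint densities *)

(** The integral over [P] depends on the outcome only through [Y], so it moves to the law of [Y];
    that law has density [p], and the result is the assumed formula for the joint law. *)
Lemma regular_cond_law_density d d1 d2 (Om : measurableType d)
    (V : measurableType d1) (W : measurableType d2) (R : realType)
    (P : probability Om R) (mu : {sigma_finite_measure set V -> \bar R})
    (nu : {sigma_finite_measure set W -> \bar R})
    (X : Om -> V) (Y : Om -> W) (p : W -> R) (k : W -> V -> R)
    (q : R.-pker W ~> V) :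
  measurable_fun [set: Om] Y ->
  (forall y, 0 <= p y) -> measurable_fun [set: W] p ->
  (forall B, measurable B -> P (Y @^-1` B) = (\int[nu]_y (p y * \1_B y)%:E)%E) ->
  (forall y A, measurable A -> q y A = (\int[mu]_x (k y x * \1_A x)%:E)%E) ->
  (forall A B, measurable A -> measurable B ->
    P (X @^-1` A `&` Y @^-1` B) =
    (\int[nu]_y ((p y * \1_B y)%:E * \int[mu]_x (k y x * \1_A x)%:E))%E) ->
  regular_cond_law P X Y q.
Proof.
move=> mY p0 mp PY qE PXY A B mA mB.
(* Bundling [Y] as a random variable makes its pushforward available as a measure. *)
pose Z : {RV P >-> W} := mfun_Sub (mem_set mY : Y \in mfun).
have mq : measurable_fun [set: W] (q ^~ A) by exact: measurable_kernel.
rewrite -(@ge0_integral_pushforward _ _ _ _ _ _ mY P B (q ^~ A))//; last first.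
  exact: measurable_funTS.
rewrite integral_mkcond epatch_indic.
rewrite (@ge0_integral_density _ _ _ nu (pushforward P Z) p)//.
- rewrite PXY//; apply: eq_integral => y _ /=.
  by rewrite -qE// EFinM muleC -muleA [(_%:E * _)%E in RHS]muleC.
- move=> C mC; rewrite /pushforward [LHS](PY C mC) [RHS]integral_mkcond.
  by apply: eq_integral => y _; rewrite epatch_indic.
- by apply: emeasurable_funM => //; apply/measurable_EFinP; exact: measurable_indic.
- by move=> y; rewrite mule_ge0// lee_fin.
Qed.

(** * The shifted diffusion process *)

Section diffusion.
Context (R : realType) (d T : nat) (C : Type) (alpha : nat -> R).
Hypothesis halpha : forall t, (1 <= t <= T)%N -> 0 < alpha t < 1.
Variables (r : 'rV[R]_d -> C -> nat -> 'rV[R]_d) (x0 : 'rV[R]_d) (c : C).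

Local Notation V := 'rV[R]_d.
Local Notation lambda := (@lebesgue_rV R d).
Local Notation abar := (alphabar alpha).
Local Notation step := (fun t => transition_pdf alpha r x0 c t.+1).

Definition marginal_pdf t : V -> R :=
  gaussian_pdf (marginal_mean alpha r x0 c t) (1 - abar t)%:M.

(** Density of x_(t+1) given x_(t+2) = [y]: the indices follow the convention for [b] in the Markov
    chain section. *)
Definition posterior_pdf t (y : V) : V -> R :=
  gaussian_pdf (posterior_mean alpha r x0 c t.+2 y) (posterior_var alpha t.+2)%:M.

Lemma alphabar0 : abar 0 = 1.
Proof. by rewrite /alphabar big_geq. Qed.

Lemma alphabarS t : abar t.+1 = abar t * alpha t.+1.
Proof. by rewrite /alphabar big_nat_recr. Qed.

Lemma alphabar_gt0 t : (t <= T)%N -> 0 < abar t.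
Proof.
elim: t => [|t IH] tT; first by rewrite alphabar0.
by rewrite alphabarS mulr_gt0 ?IH 1?ltnW//; case/andP: (halpha (t := t.+1) tT).
Qed.

(** The empty product at index 0 is 1, so the strict bound, and with it a positive marginal
    variance, starts at index 1. *)
Lemma alphabarS_lt1 t : (t < T)%N -> abar t.+1 < 1.
Proof.
elim: t => [|t IH] tT; rewrite alphabarS; have /andP[a0 a1] := halpha (t := _.+1) tT.
  by rewrite alphabar0 mul1r.
by rewrite mulr_ilt1 ?IH 1?ltW// ?alphabar_gt0 1?ltnW.
Qed.

Lemma jointly_measurable_transition_pdf t :
  jointly_measurable (transition_pdf alpha r x0 c t).
Proof.
apply: measurable_gaussian_pdf; rewrite /transition_mean.
under [X in measurable_fun _ X]eq_fun do rewrite -addrA.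
exact: measurable_affine_rV.
Qed.

Lemma integral_transition_pdf t x : (t < T)%N ->
  (\int[lambda]_y (step t x y)%:E = 1)%E.
Proof.
move=> tT; apply: integral_gaussian_pdf.
by rewrite subr_gt0; case/andP: (halpha (t := t.+1) tT).
Qed.

Lemma forward_pdf_chain (v : T.-tuple V) :
  forward_pdf alpha r x0 c v = chain step x0 v.
Proof. by rewrite -(prod_chain _ (0 : V)) /forward_pdf big_add1. Qed.

(** The shift vanishes at time 0 because [kshift] does, so the first transition from [x0] already
    has the claimed marginal form. *)
Lemma transition_pdf1 : step 0 x0 = marginal_pdf 1.
Proof.
apply/funext => y; rewrite /transition_pdf /marginal_pdf.
rewrite /transition_mean /marginal_mean /beta /= alphabarS alphabar0 mul1r.
by rewrite [bshift _ _ 0 _ _]/bshift /kshift alphabar0 sqrtr1 subrr mulr0 scale0r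
  scaler0 subr0.
Qed.

Lemma posterior_var_gt0 t : (t.+1 < T)%N -> 0 < posterior_var alpha t.+2.
Proof.
move=> tT; rewrite /posterior_var /beta /= !mulr_gt0 ?invr_gt0 ?subr_gt0//.
- exact/alphabarS_lt1/ltnW.
- by case/andP: (halpha (t := t.+2) tT).
- exact: alphabarS_lt1.
Qed.

(** Instance of [gaussian_pdf_bayes] with slope [Num.sqrt (alpha t.+2)] and the difference of shifts
    as offset; it remains to identify the three resulting parameters. *)
Lemma marginal_transition_bayes t x y : (t.+1 < T)%N ->
  marginal_pdf t.+1 x * step t.+1 x y =
  marginal_pdf t.+2 y * posterior_pdf t y x.
Proof.
move=> tT; have /andP[a0 a1] := halpha (t := t.+2) tT.
have s0 : 0 < 1 - abar t.+1 by rewrite subr_gt0; exact/alphabarS_lt1/ltnW.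
have s'0 : 0 < beta alpha t.+2 by rewrite subr_gt0.
have S0 : 0 < 1 - abar t.+2 by rewrite subr_gt0; exact: alphabarS_lt1.
have SE : Num.sqrt (alpha t.+2) ^+ 2 * (1 - abar t.+1) + beta alpha t.+2 =
    1 - abar t.+2.
  by rewrite sqr_sqrtr ?ltW// [abar t.+2]alphabarS /beta; ring.
(* The shift carried by the marginal mean at [t.+1] cancels the subtracted one, leaving only the
   shift at [t.+2]. *)
have meanE : Num.sqrt (alpha t.+2) *: marginal_mean alpha r x0 c t.+1 +
    (bshift alpha r t.+2 x0 c -
     Num.sqrt (alpha t.+2) *: bshift alpha r t.+1 x0 c) =
    marginal_mean alpha r x0 c t.+2.
  rewrite /marginal_mean [abar t.+2]alphabarS sqrtrM; last first.
    exact/ltW/alphabar_gt0/ltnW.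
  rewrite scalerDr scalerA [LHS]addrACA subrr addr0.
  by rewrite [_ * Num.sqrt (alpha _)]mulrC.
(* The shift at [t.+1] occurs twice, with total weight equal to the denominator by [SE], and so
   comes out with coefficient 1. *)
have postE : (1 - abar t.+2)^-1 *:
    (beta alpha t.+2 *: marginal_mean alpha r x0 c t.+1 +
     (Num.sqrt (alpha t.+2) * (1 - abar t.+1)) *:
       (y - (bshift alpha r t.+2 x0 c -
             Num.sqrt (alpha t.+2) *: bshift alpha r t.+1 x0 c))) =
    posterior_mean alpha r x0 c t.+2 y.
  rewrite /posterior_mean /marginal_mean; apply/rowP => i; rewrite !mxE /=.
  (* With the denominator expanded by [SE], the identity is rational in the square roots and no
     relation between them and [alpha] is used. *)
  move: S0; rewrite -SE.
  move: (Num.sqrt (alpha t.+2)) (Num.sqrt (abar t.+1)) (1 - abar t.+1)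
    (beta _ _) (kshift _ t.+1) (kshift _ t.+2) => a A s b k k' S0.
  by field; rewrite gt_eqF.
have := gaussian_pdf_bayes (marginal_mean alpha r x0 c t.+1)
  (Num.sqrt (alpha t.+2)) (bshift alpha r t.+2 x0 c -
    Num.sqrt (alpha t.+2) *: bshift alpha r t.+1 x0 c) x y s0 s'0.
rewrite SE meanE postE addrA.
exact.
Qed.

Lemma measurable_posterior_mean t :
  measurable_fun [set: V] (posterior_mean alpha r x0 c t).
Proof.
apply: measurable_fun_rVP => i; rewrite /posterior_mean.
under [X in measurable_fun _ X]eq_fun do rewrite !mxE.
apply: measurable_funD => //; apply: measurable_funD => //.
apply: measurable_funM => //; apply: measurable_funB => //.
exact: measurable_rV_coord.
Qed.

Lemma jointly_measurable_posterior_pdf t : jointly_measurable (posterior_pdf t).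
Proof.
apply: measurable_gaussian_pdf; exact: measurable_posterior_mean.
Qed.

Lemma integral_posterior_pdf t y : (t.+1 < T)%N ->
  (\int[lambda]_x (posterior_pdf t y x)%:E = 1)%E.
Proof. by move=> tT; exact/integral_gaussian_pdf/posterior_var_gt0. Qed.

Section law.
Context (disp : measure_display) (Om : measurableType disp).
Variables (P : probability Om R) (X : {RV P >-> T.-tuple V}).
Hypothesis hX : forall A : set (T.-tuple V), measurable A ->
  distribution P X A = forward_law alpha r x0 c A.

Lemma forward_law_preimage (A : set (T.-tuple V)) : measurable A ->
  P (X @^-1` A) =
  (\int[power_measure lambda T]_v (\1_A v * chain step x0 v)%:E)%E.
Proof.
move=> mA; rewrite -[LHS]/(distribution P X A) hX// /forward_law integral_mkcond.
apply: eq_integral => v _.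
by rewrite epatch_indic /= -EFinM mulrC forward_pdf_chain.
Qed.

Let measurable_state_preimage t (A : set V) : (t < T)%N -> measurable A ->
  measurable [set v : T.-tuple V | A (nth 0 v t)].
Proof.
move=> tT mA; rewrite -[X in measurable X]setTI.
exact: (measurable_tuple_nth (0 : V) tT measurableT mA).
Qed.

Lemma state_marginal t (A : set V) : (t < T)%N -> measurable A ->
  P ((fun w => state x0 (X w) t.+1) @^-1` A) =
  (\int[lambda]_y (marginal_pdf t.+1 y * \1_A y)%:E)%E.
Proof.
move=> tT mA.
(* The state of index [t.+1] is entry [t] of the tuple by conversion, so the event is the preimage
   of a measurable set of tuples. *)
apply: etrans (forward_law_preimage (measurable_state_preimage tT mA)) _.
apply: (@markov_chain_marginal _ V R lambda T step x0 _ _ _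
  (fun t => marginal_pdf t.+1) posterior_pdf _ _ _ _ _ _ _ t 0 A).
- by move=> ?; exact: jointly_measurable_transition_pdf.
- by move=> *; exact: gaussian_pdf_ge0.
- by move=> *; exact: integral_transition_pdf.
- by move=> ?; exact: measurable_gaussian_pdfr.
- by move=> *; exact: gaussian_pdf_ge0.
- by apply/esym; exact: transition_pdf1.
- by move=> *; exact: jointly_measurable_posterior_pdf.
- by move=> *; exact: gaussian_pdf_ge0.
- by move=> *; exact: integral_posterior_pdf.
- by move=> *; exact: marginal_transition_bayes.
- exact: tT.
- exact: mA.
Qed.

Lemma state_joint t (A B : set V) : (t.+1 < T)%N ->
  measurable A -> measurable B ->
  P ((fun w => state x0 (X w) t.+1) @^-1` A `&`
     (fun w => state x0 (X w) t.+2) @^-1` B) =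
  (\int[lambda]_y ((marginal_pdf t.+2 y * \1_B y)%:E *
    \int[lambda]_x (posterior_pdf t y x * \1_A x)%:E))%E.
Proof.
move=> tT mA mB.
have mAB := measurableI _ _ (measurable_state_preimage (ltnW tT) mA)
  (measurable_state_preimage tT mB).
apply: etrans (forward_law_preimage mAB) _.
(* The indicator of the intersection becomes the product of indicators expected by
   [markov_chain_joint]. *)
under eq_integral do rewrite indicI.
apply: (@markov_chain_joint _ V R lambda T step x0 _ _ _
  (fun t => marginal_pdf t.+1) posterior_pdf _ _ _ _ _ _ _ t 0 A B).
- by move=> ?; exact: jointly_measurable_transition_pdf.
- by move=> *; exact: gaussian_pdf_ge0.
- by move=> *; exact: integral_transition_pdf.
- by move=> ?; exact: measurable_gaussian_pdfr.
- by move=> *; exact: gaussian_pdf_ge0.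
- by apply/esym; exact: transition_pdf1.
- by move=> *; exact: jointly_measurable_posterior_pdf.
- by move=> *; exact: gaussian_pdf_ge0.
- by move=> *; exact: integral_posterior_pdf.
- by move=> *; exact: marginal_transition_bayes.
- exact: tT.
- exact: mA.
- exact: mB.
Qed.

Lemma measurable_state t : (t < T)%N ->
  measurable_fun [set: Om] (fun w => state x0 (X w) t.+1).
Proof.
move=> tT; apply: (measurableT_comp
  (measurable_tuple_nth (0 : V) tT : measurable_fun [set: T.-tuple V] _)).
exact: measurable_funPT.
Qed.

End law.
End diffusion.

Theorem proposition1 (R : realType) (d T : nat) (hT : (1 <= T)%N) (C : Type)
  (alpha : nat -> R)
  (halpha : forall t : nat, (1 <= t <= T)%N -> 0 < alpha t < 1)
  (r : 'rV[R]_d -> C -> nat -> 'rV[R]_d)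
  (x0 : 'rV[R]_d) (c : C)
  (disp : measure_display) (Om : measurableType disp) (P : probability Om R)
  (X : {RV P >-> T.-tuple 'rV[R]_d})
  (hX : forall A : set (T.-tuple 'rV[R]_d), measurable A ->
    distribution P X A = forward_law alpha r x0 c A) :
  (forall t : nat, (1 <= t <= T)%N ->
    forall A : set 'rV[R]_d, measurable A ->
      P ((fun w => state x0 (X w) t) @^-1` A) =
      gaussian_law (marginal_mean alpha r x0 c t) (1 - alphabar alpha t)%:M A)
  /\
  (forall t : nat, (1 < t <= T)%N ->
    exists q : R.-pker 'rV[R]_d ~> 'rV[R]_d,
      (forall (xt : 'rV[R]_d) (A : set 'rV[R]_d), measurable A ->
        q xt A = gaussian_law (posterior_mean alpha r x0 c t xt)
                              (posterior_var alpha t)%:M A) /\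
      regular_cond_law P (fun w => state x0 (X w) t.-1)
                         (fun w => state x0 (X w) t) q).
Proof.
(* The bounds on time exclude 0 for the marginals and 0, 1 for the posteriors, which leaves times
   [t.+1] and [t.+2]. *)
split=> [[//|t] tT A mA|[|[|t]] // tT].
  by rewrite (state_marginal halpha hX tT mA) gaussian_law_indic.
(* Measurability of the posterior mean in x_t and positivity of the posterior variance make the
   Gaussian family a probability kernel. *)
exists (gaussian_kernel (measurable_posterior_mean alpha r x0 c t.+2)
  (posterior_var_gt0 halpha tT)).
split=> //.
apply: (regular_cond_law_density (mu := @lebesgue_rV R d)
  (nu := @lebesgue_rV R d) (p := marginal_pdf alpha r x0 c t.+2)
  (k := posterior_pdf alpha r x0 c t)).
- exact: measurable_state.
- by move=> y; exact: gaussian_pdf_ge0.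
- exact: measurable_gaussian_pdfr.
- by move=> B mB; exact: state_marginal.
- by move=> y A mA; exact: gaussian_law_indic.
- by move=> A B mA mB; exact: state_joint.
Qed.
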